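(* ${}^*\mathbb{C}$ is an algebraically closed field. That is, every polynomial of non-zero degree with coefficients in ${}^*\mathbb{C}$ has a root in ${}^*\mathbb{C}$.
   Context: $\mathbb{R}_+$ is the set of positive real numbers and $\mathbb{N}=\{1,2,3,\dots\}$. Fix an ultrafilter $\mathcal{U}$ on $\mathbb{R}_+$ such that $(0,\tfrac1n)\in\mathcal{U}$ for all $n\in\mathbb{N}$. A property of $\varepsilon\in\mathbb{R}_+$ holds almost everywhere (a.e.) if the set of $\varepsilon$ for which it holds belongs to $\mathcal{U}$. For nets $(a_\varepsilon),(b_\varepsilon)\in\mathbb{C}^{\mathbb{R}_+}$ write $(a_\varepsilon)\sim(b_\varepsilon)$ if $a_\varepsilon=b_\varepsilon$ a.e.; ${}^*\mathbb{C}=\mathbb{C}^{\mathbb{R}_+}/\!\sim$ is the factor ring, with operations induced from the pointwise operations on $\mathbb{C}^{\mathbb{R}_+}$. *)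

(* Defs.v *)
From HB Require Import structures.
From mathcomp Require Import all_boot all_order all_algebra generic_quotient.
From mathcomp Require Import interval_inference.
From mathcomp Require Import all_classical reals complex.

Set Implicit Arguments.
Unset Strict Implicit.
Unset Printing Implicit Defensive.
Import Order.TTheory GRing.Theory Num.Theory.
Local Open Scope classical_set_scope.
Local Open Scope ring_scope.
Local Open Scope complex_scope.
Local Open Scope quotient_scope.

(* The ring structure is the pointwise one on functions. *)
Definition cnet (R : realType) : Type := ({posnum R} -> R[i])%type.
HB.instance Definition _ (R : realType) := GRing.ComPzRing.on (cnet R).

Section hypercomplex.
Variables (R : realType) (U : set_system {posnum R}) (UU : UltraFilter U).
Implicit Types a b c : cnet R.

(* Nothing beyond properness of U is used to build the quotient ring. *)
Let filterU : Filter U.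
Proof. by case: UU => -[]. Qed.

Definition ae_eq a b : bool := `[< U [set e | a e = b e] >].

Lemma ae_eqP a b : reflect (U [set e | a e = b e]) (ae_eq a b).
Proof. exact: asboolP. Qed.

Lemma ae_eq_equiv : equiv_class_of ae_eq.
Proof.
split=> [a|a b|b a c].
- by apply/ae_eqP; apply: filterS filterT => e.
- by apply/ae_eqP/ae_eqP; apply: filterS => e /= ->.
- move=> /ae_eqP ab /ae_eqP bc; apply/ae_eqP.
  by apply: filterS2 ab bc => e /= -> ->.
Qed.

Canonical ae_eq_equivRel := EquivRelPack ae_eq_equiv.
Canonical ae_eq_encModRel := defaultEncModRel ae_eq.

(* The proof UU is an argument of the type, so that the ring structure below
   can be inferred from the type alone. *)
Definition hypercomplex := {eq_quot ae_eq}.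

HB.instance Definition _ : EqQuotient (cnet R) ae_eq hypercomplex :=
  EqQuotient.on hypercomplex.
HB.instance Definition _ := Choice.on hypercomplex.

Lemma pi_ae_eqP a b :
  U [set e | a e = b e] <-> \pi_hypercomplex a = \pi_hypercomplex b.
Proof.
split=> [ab|/eqP]; first by apply/eqP; rewrite piE; apply/ae_eqP.
by rewrite piE => /ae_eqP.
Qed.

Let repr_ae a : U [set e | repr (\pi_hypercomplex a) e = a e].
Proof. by apply/pi_ae_eqP; rewrite reprK. Qed.

Definition hc_zero : hypercomplex := lift_cst hypercomplex (0 : cnet R).
Definition hc_one : hypercomplex := lift_cst hypercomplex (1 : cnet R).
Definition hc_opp := lift_op1 hypercomplex (-%R : cnet R -> cnet R).
Definition hc_add :=
  lift_op2 hypercomplex (+%R : cnet R -> cnet R -> cnet R).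
Definition hc_mul :=
  lift_op2 hypercomplex ( *%R : cnet R -> cnet R -> cnet R).

Canonical pi_hc_zero_morph := PiConst hc_zero.
Canonical pi_hc_one_morph := PiConst hc_one.

Lemma pi_hc_opp : {morph \pi_hypercomplex : a / - a >-> hc_opp a}.
Proof.
move=> a; unlock hc_opp; apply/pi_ae_eqP.
by apply: filterS (repr_ae a) => e /= h; rewrite /GRing.opp /= h.
Qed.
Canonical pi_hc_opp_morph := PiMorph1 pi_hc_opp.

Lemma pi_hc_add : {morph \pi_hypercomplex : a b / a + b >-> hc_add a b}.
Proof.
move=> a b /=; unlock hc_add; apply/pi_ae_eqP.
by apply: filterS2 (repr_ae a) (repr_ae b) => e /= h k;
  rewrite /GRing.add /= h k.
Qed.
Canonical pi_hc_add_morph := PiMorph2 pi_hc_add.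

Lemma pi_hc_mul : {morph \pi_hypercomplex : a b / a * b >-> hc_mul a b}.
Proof.
move=> a b /=; unlock hc_mul; apply/pi_ae_eqP.
by apply: filterS2 (repr_ae a) (repr_ae b) => e /= h k;
  rewrite /GRing.mul /= h k.
Qed.
Canonical pi_hc_mul_morph := PiMorph2 pi_hc_mul.

Lemma hc_addA : associative hc_add.
Proof. by move=> x y z; rewrite -[x]reprK -[y]reprK -[z]reprK !piE addrA. Qed.

Lemma hc_addC : commutative hc_add.
Proof. by move=> x y; rewrite -[x]reprK -[y]reprK !piE addrC. Qed.

Lemma hc_add0 : left_id hc_zero hc_add.
Proof. by move=> x; rewrite -[x]reprK !piE add0r. Qed.

Lemma hc_addN : left_inverse hc_zero hc_opp hc_add.
Proof. by move=> x; rewrite -[x]reprK !piE addNr. Qed.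

HB.instance Definition _ :=
  GRing.isZmodule.Build hypercomplex hc_addA hc_addC hc_add0 hc_addN.

Lemma hc_mulA : associative hc_mul.
Proof. by move=> x y z; rewrite -[x]reprK -[y]reprK -[z]reprK !piE mulrA. Qed.

Lemma hc_mulC : commutative hc_mul.
Proof. by move=> x y; rewrite -[x]reprK -[y]reprK !piE mulrC. Qed.

Lemma hc_mul1 : left_id hc_one hc_mul.
Proof. by move=> x; rewrite -[x]reprK !piE mul1r. Qed.

Lemma hc_mulDl : left_distributive hc_mul hc_add.
Proof.
by move=> x y z; rewrite -[x]reprK -[y]reprK -[z]reprK !piE mulrDl.
Qed.

Lemma hc_one_neq0 : hc_one != hc_zero.
Proof.
rewrite piE; apply/negP => /ae_eqP U10.
apply: (@filter_not_empty _ U); apply: filterS U10 => e /=.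
by move/eqP; rewrite oner_eq0.
Qed.

(* This includes 1 != 0, the non-triviality required of a field. *)
HB.instance Definition _ := GRing.Zmodule_isComNzRing.Build hypercomplex
  hc_mulA hc_mulC hc_mul1 hc_mulDl hc_one_neq0.

Lemma pi_hc_zeroE : \pi_hypercomplex (0 : cnet R) = 0.
Proof. exact: lock. Qed.

Lemma pi_hc_oneE : \pi_hypercomplex (1 : cnet R) = 1.
Proof. exact: lock. Qed.

Lemma pi_hc_oppE a : \pi_hypercomplex (- a) = - \pi_hypercomplex a.
Proof. exact: pi_hc_opp. Qed.

Lemma pi_hc_addE a b :
  \pi_hypercomplex (a + b) = \pi_hypercomplex a + \pi_hypercomplex b.
Proof. exact: pi_hc_add. Qed.

Lemma pi_hc_mulE a b :
  \pi_hypercomplex (a * b) = \pi_hypercomplex a * \pi_hypercomplex b.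
Proof. exact: pi_hc_mul. Qed.

End hypercomplex.

(* Main.v *)
Require Import Defs.
From mathcomp Require Import all_boot all_order all_algebra.
From mathcomp Require Import interval_inference all_classical reals.
From mathcomp Require Import generic_quotient complex.
Import GRing.Theory Num.Theory.
Local Open Scope classical_set_scope.
Local Open Scope ring_scope.

(** An ultrafilter decides whether a net vanishes a.e. or is nonzero a.e., so
    a nonzero class is inverted pointwise, and a polynomial over the quotient
    lifts to a net of complex polynomials that have the same degree a.e.;
    choosing a root of each of them gives a net of roots. *)

Section hypercomplex_theory.
Variables (R : realType) (U : set_system {posnum R}) (UU : UltraFilter U).

Local Notation piC := (\pi_(hypercomplex UU)%qT : cnet R -> hypercomplex UU).

Lemma pi_hc_surj (x : hypercomplex UU) : exists a, piC a = x.
Proof. by exists (generic_quotient.repr x); rewrite reprK. Qed.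

(** By the ultrafilter dichotomy, the zero set of [a] or its complement is in [U]; the former would
    make the class zero. *)
Lemma pi_hc_neq0 (a : cnet R) : piC a != 0 -> U [set e | a e != 0].
Proof.
move=> a0; have [az|] := in_ultra_setVsetC [set e | a e = 0] UU.
  by case/eqP: a0; rewrite -pi_hc_zeroE; apply/pi_ae_eqP.
by apply: filterS => e /= /eqP.
Qed.

Lemma pi_hc_expE (a : cnet R) n : piC (fun e => a e ^+ n) = piC a ^+ n.
Proof.
elim: n => [|n IHn]; first exact: pi_hc_oneE.
rewrite exprS -IHn -pi_hc_mulE; congr (piC _).
by apply/funext => e; rewrite exprS.
Qed.

Lemma pi_hc_sumE n (F : 'I_n -> cnet R) :
  piC (fun e => \sum_(i < n) F i e) = \sum_(i < n) piC (F i).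
Proof.
rewrite -(big_morph piC (@pi_hc_addE _ _ UU) (@pi_hc_zeroE _ _ UU)).
by congr (piC _); apply/funext => e; rewrite fct_sumE.
Qed.

Lemma hc_invertible (x : hypercomplex UU) : x != 0 -> exists y, x * y = 1.
Proof.
have [a <-] := pi_hc_surj x => /pi_hc_neq0 a0.
(* Where [a e = 0] the inverse is 0 by convention; such [e] form a set outside [U]. *)
exists (piC (fun e => (a e)^-1)); rewrite -pi_hc_mulE -pi_hc_oneE.
by apply/pi_ae_eqP; apply: filterS a0 => e; exact: mulfV.
Qed.

Lemma hc_root (p : {poly hypercomplex UU}) : (1 < size p)%N ->
  exists z, root p z.
Proof.
move=> p1; pose c i : cnet R := generic_quotient.repr p`_i.
have cE i : piC (c i) = p`_i by rewrite reprK.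
pose P e := \poly_(i < size p) c i e.
have Pdeg : U [set e | size (P e) = size p].
  (* [P e] has smaller size than [p] only where the net lifting the leading coefficient vanishes. *)
  have : piC (c (size p).-1) != 0.
    by rewrite cE -lead_coefE lead_coef_eq0 -size_poly_gt0 ltnW.
  by move=> /pi_hc_neq0; apply: filterS => e; exact: size_poly_eq.
(* The default 0 is taken only where [P e] is a nonzero constant. *)
pose z e := xget 0 [set w | root (P e) w].
exists (piC z); apply/rootP; rewrite horner_coef.
(* Evaluation passes to classes because the number of terms, [size p], does not depend on [e]. *)
transitivity (piC (fun e => (P e).[z e])).
  under [in RHS]eq_fun do rewrite horner_poly.
  rewrite (pi_hc_sumE _ (fun i e => c i e * z e ^+ i)).
  apply: eq_bigr => i _; rewrite -cE -pi_hc_expE -pi_hc_mulE.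
  by congr (piC _).
rewrite -pi_hc_zeroE; apply/pi_ae_eqP; apply: filterS Pdeg => e /= Pe.
apply/rootP; rewrite /z; case: xgetP => [w -> //|Proot].
(* Algebraic closedness of [R[i]] rules out the default case. *)
have /closed_rootP[w /Proot//] : size (P e) != 1%N.
by rewrite Pe gtn_eqF.
Qed.

End hypercomplex_theory.

Theorem theorem2p4p1 (R : realType) (U : set_system {posnum R})
    (UU : UltraFilter U)
    (hU : forall n : nat, (0 < n)%N ->
       U [set e : {posnum R} | e%:num < n%:R^-1]) :
  (forall x : hypercomplex UU, x != 0 ->
     exists y : hypercomplex UU, x * y = 1) /\
  (forall p : {poly hypercomplex UU}, (1 < size p)%N ->
     exists z : hypercomplex UU, root p z).
Proof. by split; [exact: hc_invertible | exact: hc_root]. Qed.
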